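(* Let $d\geq 11$ be an odd integer. Then there exists a set $\mathcal{S}$ of mutually orthogonal pure product states (i.e. an orthogonal set without entanglement) in $\mathbb{C}^d\otimes\mathbb{C}^d$ which has genuine hidden nonlocality of type I.
   Context: States are nonzero vectors, possibly unnormalized, in a bipartite space $\mathcal{H}_A\otimes\mathcal{H}_B$, with Alice holding $\mathcal{H}_A$ and Bob holding $\mathcal{H}_B$. A pure state is a product state if it has the form $|a\rangle\otimes|b\rangle$; a set is without entanglement if all its elements are product states. **Local distinguishability.** A finite set of mutually orthogonal states is *locally distinguishable* if there is a protocol of local operations and classical communication (LOCC), i.e. a sequence of local quantum measurements by Alice and Bob, each chosen depending on all previously communicated outcomes, that identifies with certainty which state of the (known) set was prepared. Otherwise it is *locally indistinguishable*. **Orthogonality-preserving local measurement (OPLM).** A local measurement is given by Kraus operators $K_\mu$ acting locally: Alice and/or Bob perform a measurement on their own system, so $K_\mu=M_a\otimes N_b$ with $\mu=(a,b)$, $\sum_a M_a^\dagger M_a=\mathbb{I}$, $\sum_b N_b^\dagger N_b=\mathbb{I}$ (a party doing nothing has the single operator $\mathbb{I}$). For a set $\mathcal{S}$ and an outcome $\mu$, the set of post-measurement states is $\mathcal{S}'_\mu=\{K_\mu|\psi\rangle : |\psi\rangle\in\mathcal{S},\ K_\mu|\psi\rangle\neq 0\}$. The measurement is an OPLM for $\mathcal{S}$ if for every outcome $\mu$ the vectors $K_\mu|\psi\rangle$, $|\psi\rangle\in\mathcal{S}$, are mutually orthogonal. Always $|\mathcal{S}'_\mu|\le|\mathcal{S}|$.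 **Local redundancy.** An orthogonal set $\mathcal{S}$ is *locally redundant* if it remains orthogonal after discarding one or more subsystems. Here each party's space may be identified, through an arbitrary local unitary, with a tensor product of smaller spaces (e.g. $\mathbb{C}^d\cong\bigotimes_i\mathbb{C}^{p_i}$ where $d=\prod_i p_i$ with $p_i$ prime), and discarding means taking the partial trace over a nonempty collection of these tensor factors (of Alice's and/or Bob's space); remaining orthogonal means that the resulting reduced density operators of distinct elements of $\mathcal{S}$ are pairwise orthogonal for the inner product $\langle\rho,\sigma\rangle=\mathrm{Tr}[\rho^\dagger\sigma]$. Otherwise $\mathcal{S}$ is *locally irredundant*. **Genuine hidden nonlocality of type I.** $\mathcal{S}$ has this property if $\mathcal{S}$ is locally distinguishable and locally irredundant, and there is some OPLM such that for each outcome $\mu$ the set of post-measurement states $\mathcal{S}'_\mu$ is locally indistinguishable and $|\mathcal{S}'_\mu|=|\mathcal{S}|$. *)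

(* Defs.v *)
(* The complex numbers are R[i] for R : realType; the definitions make sense over
   any numClosedFieldType. *)
From HB Require Import structures.
From mathcomp Require Import all_boot all_order all_algebra.
From mathcomp Require Import finmap.
From mathcomp Require Import reals complex.
From mathcomp Require mxtens.

Set Implicit Arguments.
Unset Strict Implicit.
Unset Printing Implicit Defensive.

Import Order.TTheory GRing.Theory Num.Theory.

Local Open Scope ring_scope.
Local Open Scope sesquilinear_scope.

(* The file mxtens is not imported, as its "A ^t k" clashes with "M ^t phi". *)
Notation "A *t B" := (mxtens.tensmx A B)
  (at level 40, left associativity, format "A  *t  B") : ring_scope.

Section LocalDiscrimination.
Variable C : numClosedFieldType.

(* C^m (x) C^n is represented by 'cV_(m * n); the entry of a *t b at
   mxtens_index (i, j) is a_i * b_j. *)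
Definition product_state m n (psi : 'cV[C]_(m * n)) : Prop :=
  exists (a : 'cV[C]_m) (b : 'cV[C]_n), psi = a *t b.

Definition without_entanglement m n (S : {fset 'cV[C]_(m * n)}) : Prop :=
  forall psi, psi \in S -> product_state psi.

Definition orthogonal_states N (S : {fset 'cV[C]_N}) : Prop :=
  (forall psi, psi \in S -> psi != 0) /\
  (forall psi phi, psi \in S -> phi \in S -> psi != phi ->
     psi ^t* *m phi = 0).

(* Kraus operators of a measurement with outcomes in 'I_k; outcome i maps C^m
   to C^(dim i), so that adjoining or discarding ancillas is covered. *)
Definition measurement m k (dim : 'I_k -> nat)
    (M : forall i, 'M[C]_(dim i, m)) : Prop :=
  \sum_i (M i) ^t* *m M i = 1%:M.

(* A finite-round protocol is a tree whose leaves announce a label in X; each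
   measurement depends on all the earlier outcomes, through the branch taken. *)
Inductive locc_protocol (X : Type) : nat -> nat -> Type :=
| Announce m n of X : locc_protocol X m n
| AliceMeasures m n k (dim : 'I_k -> nat) (M : forall i, 'M[C]_(dim i, m))
    of measurement M & (forall i, locc_protocol X (dim i) n) :
    locc_protocol X m n
| BobMeasures m n k (dim : 'I_k -> nat) (N : forall j, 'M[C]_(dim j, n))
    of measurement N & (forall j, locc_protocol X m (dim j)) :
    locc_protocol X m n.

(* Run on psi, the protocol announces x with probability one: the branches that
   are exempted are those where the unnormalized state is 0, which are the ones
   of probability zero. *)
Fixpoint announces X m n (P : locc_protocol X m n) (x : X) :
    'cV[C]_(m * n) -> Prop :=
  match P in locc_protocol _ m n return 'cV[C]_(m * n) -> Prop with
  | Announce _ _ y => fun psi => psi != 0 -> y = x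
  | AliceMeasures _ n _ _ M _ Q => fun psi =>
      forall i, announces (Q i) x ((M i *t (1%:M : 'M_n)) *m psi)
  | BobMeasures m _ _ _ N _ Q => fun psi =>
      forall j, announces (Q j) x (((1%:M : 'M_m) *t N j) *m psi)
  end.

Definition locally_distinguishable m n (S : {fset 'cV[C]_(m * n)}) : Prop :=
  exists P : locc_protocol 'cV[C]_(m * n) m n,
    forall psi, psi \in S -> announces P psi psi.

Definition locally_indistinguishable m n (S : {fset 'cV[C]_(m * n)}) : Prop :=
  ~ locally_distinguishable S.

Definition post_measurement_states N N' (K : 'M[C]_(N', N))
    (S : {fset 'cV[C]_N}) : {fset 'cV[C]_N'} :=
  [fset K *m psi | psi in S & K *m psi != 0]%fset.

(* Outcomes are pairs (a, b); a party doing nothing has the single operator 1. *)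
Definition oplm m n k l (M : 'I_k -> 'M[C]_m) (N : 'I_l -> 'M[C]_n)
    (S : {fset 'cV[C]_(m * n)}) : Prop :=
  [/\ measurement M, measurement N &
      forall a b psi phi, psi \in S -> phi \in S -> psi != phi ->
        ((M a *t N b) *m psi) ^t* *m ((M a *t N b) *m phi) = 0].

Definition multi_index (I : finType) (p : I -> nat) : finType :=
  {dffun forall i : I, 'I_(p i)}.

Definition restrict (I : finType) (p : I -> nat) (T : {set I})
    (u : multi_index p) : multi_index (fun j : {i | i \in T} => p (val j)) :=
  finfun (fun j : {i | i \in T} => u (val j)).

(* An identification of C^d with the tensor product of the C^(p i), whose
   canonical basis is enumerated by multi-indices. Factors of dimension 1 are
   excluded: discarding them would discard nothing. *)
Definition tensor_factorization d k (p : 'I_k -> nat)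
    (U : 'M[C]_(#|multi_index p|, d)) : Prop :=
  [/\ forall i, (1 < p i)%N, U ^t* *m U = 1%:M & U *m U ^t* = 1%:M].

(* The operator 1 (x) <z| from the product of all the factors to the product of
   those outside T, where z is a multi-index for the factors in T. *)
Definition partial_bra k (p : 'I_k -> nat) (T : {set 'I_k})
    (z : multi_index (fun j : {i | i \in T} => p (val j))) :
    'M[C]_(#|multi_index (fun j : {i | i \in ~: T} => p (val j))|,
           #|multi_index p|) :=
  \matrix_(x, u) ((restrict (~: T) (enum_val u) == enum_val x)
                  && (restrict T (enum_val u) == z))%:R.

(* Partial trace of |psi><psi| over the factors in TA and TB:
   sum over z, w of (1 (x) <z,w|) |psi><psi| (1 (x) |z,w>). *)
Definition reduced_density m n
    kA (pA : 'I_kA -> nat) (UA : 'M[C]_(#|multi_index pA|, m)) (TA : {set 'I_kA})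
    kB (pB : 'I_kB -> nat) (UB : 'M[C]_(#|multi_index pB|, n)) (TB : {set 'I_kB})
    (psi : 'cV[C]_(m * n)) :=
  \sum_(z : multi_index (fun j : {i | i \in TA} => pA (val j)))
  \sum_(w : multi_index (fun j : {i | i \in TB} => pB (val j)))
    let L := (partial_bra z *m UA) *t (partial_bra w *m UB) in
    L *m (psi *m psi ^t*) *m L ^t*.

Definition locally_redundant m n (S : {fset 'cV[C]_(m * n)}) : Prop :=
  exists kA (pA : 'I_kA -> nat) (UA : 'M[C]_(#|multi_index pA|, m))
         (TA : {set 'I_kA})
         kB (pB : 'I_kB -> nat) (UB : 'M[C]_(#|multi_index pB|, n))
         (TB : {set 'I_kB}),
    [/\ tensor_factorization UA, tensor_factorization UB,
        (TA != set0) || (TB != set0) &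
        forall psi phi, psi \in S -> phi \in S -> psi != phi ->
          \tr ((reduced_density UA TA UB TB psi) ^t*
               *m reduced_density UA TA UB TB phi) = 0].

Definition locally_irredundant m n (S : {fset 'cV[C]_(m * n)}) : Prop :=
  ~ locally_redundant S.

Definition genuine_hidden_nonlocality_typeI m n
    (S : {fset 'cV[C]_(m * n)}) : Prop :=
  [/\ locally_distinguishable S, locally_irredundant S &
      exists k l (M : 'I_k -> 'M[C]_m) (N : 'I_l -> 'M[C]_n),
        oplm M N S /\
        forall a b,
          let S' := post_measurement_states (M a *t N b) S in
          @locally_indistinguishable m n S' /\ #|` S'| = #|` S|].

End LocalDiscrimination.

(* Main.v *)
(* Write Alice's space as C^3 (+) C^3 (+) C^n with d = n + 6, and split the
   eight border domino states of C^3 (x) C^3 into two halves, Alice's part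
   of the first half being put in the first copy of C^3 and that of the
   second half in the second copy. Alice can learn the half, and each half
   is easy to discriminate; but a measurement that merges the two copies
   turns these states into the domino states, which no LOCC protocol
   discriminates, since a measurement operator of either party that keeps
   them orthogonal is a multiple of an isometry. All product basis vectors
   with Alice's part in C^n are added. They give Alice n and Bob d
   orthogonal vectors that occur with a common partner; if the set were
   locally redundant, their pairwise orthogonal reductions would live in
   dimension at most d/3 (d being odd), while n = d - 6 > d/3 for d > 9. *)
Require Import Defs.
From mathcomp Require Import all_boot all_order all_algebra.
From mathcomp Require Import finmap.
From mathcomp Require Import reals complex.
From mathcomp Require mxtens.
From mathcomp Require Import zify ring.

Set Implicit Arguments.
Unset Strict Implicit.
Unset Printing Implicit Defensive.

Import Order.TTheory GRing.Theory Num.Theory.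

Local Open Scope ring_scope.
Local Open Scope sesquilinear_scope.

(** * Adjoints, inner products and tensor products of column vectors *)

Section InnerProduct.
Variable C : numClosedFieldType.

Lemma adjointM m n p (A : 'M[C]_(m, n)) (B : 'M_(n, p)) :
  (A *m B) ^t* = B ^t* *m A ^t*.
Proof. by rewrite trmx_mul map_mxM. Qed.

Lemma adjoint_sum m n (I : finType) (J : pred I) (A : I -> 'M[C]_(m, n)) :
  (\sum_(i | J i) A i) ^t* = \sum_(i | J i) (A i) ^t*.
Proof.
apply/matrixP => x y; rewrite !mxE !summxE rmorph_sum.
by apply: eq_bigr => i _; rewrite !mxE.
Qed.

Lemma adjoint_tens m n p q (A : 'M[C]_(m, n)) (B : 'M_(p, q)) :
  (A *t B) ^t* = A ^t* *t B ^t*.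
Proof. by rewrite mxtens.trmx_tens mxtens.map_mxT. Qed.

Definition inner m (u v : 'cV[C]_m) : C := (u ^t* *m v) 0 0.

Lemma innerE m (u v : 'cV[C]_m) : inner u v = \sum_i (u i 0)^* * v i 0.
Proof. by rewrite /inner !mxE; apply: eq_bigr => i _; rewrite !mxE. Qed.

Lemma inner_eq0P m (u v : 'cV[C]_m) : u ^t* *m v = 0 <-> inner u v = 0.
Proof.
split=> [uv0|uv0]; first by rewrite /inner uv0 mxE.
by apply/matrixP => i j; rewrite !ord1 [LHS]uv0 mxE.
Qed.

Lemma inner_conj m (u v : 'cV[C]_m) : inner v u = (inner u v)^*.
Proof.
rewrite !innerE rmorph_sum; apply: eq_bigr => i _ /=.
by rewrite rmorphM /= conjCK mulrC.
Qed.

Lemma inner_sym0 m (u v : 'cV[C]_m) : inner u v = 0 -> inner v u = 0.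
Proof. by rewrite (inner_conj u v) => ->; rewrite conjC0. Qed.

Lemma inner_self_eq0 m (u : 'cV[C]_m) : (inner u u == 0) = (u == 0).
Proof.
apply/eqP/eqP => [|->]; last by rewrite /inner mulmx0 mxE.
have uu_ge0 i : true -> 0 <= (u i 0)^* * u i 0.
  by rewrite mulrC mul_conjC_ge0.
rewrite innerE => /(psumr_eq0P uu_ge0) u0; apply/colP => i; rewrite mxE.
by apply/eqP; rewrite -mul_conjC_eq0 mulrC u0.
Qed.

Lemma inner_mulmx m n (A : 'M[C]_(n, m)) (u : 'cV_m) (v : 'cV_n) :
  inner (A *m u) v = inner u (A ^t* *m v).
Proof. by rewrite /inner adjointM mulmxA. Qed.

Lemma inner_sandwich m n p (A : 'M[C]_(n, m)) (B : 'M_(p, n)) (u v : 'cV_m) :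
  inner (B *m (A *m u)) (B *m (A *m v)) =
  inner u ((A ^t* *m (B ^t* *m B) *m A) *m v).
Proof. by rewrite !inner_mulmx !mulmxA. Qed.

Lemma inner0l m (v : 'cV[C]_m) : inner 0 v = 0.
Proof. by rewrite innerE big1 // => i _; rewrite mxE conjC0 mul0r. Qed.

Lemma inner0r m (v : 'cV[C]_m) : inner v 0 = 0.
Proof. by rewrite /inner mulmx0 mxE. Qed.

Lemma innerZl m (c : C) (u v : 'cV_m) : inner (c *: u) v = c^* * inner u v.
Proof.
rewrite !innerE mulr_sumr; apply: eq_bigr => i _.
by rewrite mxE rmorphM mulrA.
Qed.

Lemma innerZr m (c : C) (u v : 'cV_m) : inner u (c *: v) = c * inner u v.
Proof. by rewrite /inner -scalemxAr mxE. Qed.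

Lemma inner_sumr m (I : finType) (u : 'cV[C]_m) (v : I -> 'cV_m) :
  inner u (\sum_i v i) = \sum_i inner u (v i).
Proof. by rewrite /inner mulmx_sumr summxE. Qed.

Lemma inner_col_mx m n (u u' : 'cV[C]_m) (v v' : 'cV_n) :
  inner (col_mx u v) (col_mx u' v') = inner u u' + inner v v'.
Proof. by rewrite /inner tr_col_mx map_row_mx mul_row_col mxE. Qed.

Lemma inner_deltal m (i : 'I_m) (v : 'cV[C]_m) : inner (delta_mx i 0) v = v i 0.
Proof.
rewrite innerE (bigD1 i) //= big1 ?addr0 => [|k ki].
  by rewrite !mxE !eqxx rmorph1 mul1r.
by rewrite !mxE (negPf ki) rmorph0 mul0r.
Qed.

Lemma inner_delta m (i j : 'I_m) :
  inner (delta_mx i 0 : 'cV[C]_m) (delta_mx j 0) = (i == j)%:R.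
Proof. by rewrite inner_deltal mxE eqxx andbT. Qed.

Lemma innerDr m (u v v' : 'cV[C]_m) : inner u (v + v') = inner u v + inner u v'.
Proof. by rewrite /inner mulmxDr mxE. Qed.

Lemma innerDl m (u u' v : 'cV[C]_m) : inner (u + u') v = inner u v + inner u' v.
Proof. by rewrite !(inner_conj v) innerDr rmorphD. Qed.

Lemma sum_inner_measurement m k (dim : 'I_k -> nat)
    (M : forall i, 'M[C]_(dim i, m)) (u v : 'cV_m) :
  measurement M -> \sum_i inner (M i *m u) (M i *m v) = inner u v.
Proof.
move=> MM; rewrite -[in RHS](mul1mx v) -MM mulmx_suml inner_sumr.
by apply: eq_bigr => i _; rewrite inner_mulmx mulmxA.
Qed.

Lemma measurement_of_inner m k (M : 'I_k -> 'M[C]_m) :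
  (forall u v, \sum_i inner (M i *m u) (M i *m v) = inner u v) -> measurement M.
Proof.
move=> MM; apply/matrixP => x y; rewrite [RHS]mxE -inner_delta -MM summxE.
by apply: eq_bigr => i _; rewrite inner_mulmx mulmxA inner_deltal -colE [RHS]mxE.
Qed.

(** The ascribed type identifies the column count [1 * 1] of [a *t b] with [1] by conversion, so
    that lemmas on column vectors apply. *)
Definition tens m n (a : 'cV[C]_m) (b : 'cV[C]_n) : 'cV[C]_(m * n) := a *t b.

Lemma mul_tens m n p q (A : 'M[C]_(p, m)) (B : 'M_(q, n)) a b :
  (A *t B) *m tens a b = tens (A *m a) (B *m b).
Proof. exact: (mxtens.tensmx_mul A B a b). Qed.

Lemma tensE m n (a : 'cV[C]_m) (b : 'cV_n) i j :
  tens a b (mxtens.mxtens_index (i, j)) 0 = a i 0 * b j 0.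
Proof.
have := mxtens.tensmxE a b i j 0 0; rewrite /tens => <-.
by congr (_ _ _); apply: val_inj.
Qed.

Lemma inner_tens m n (a a' : 'cV[C]_m) (b b' : 'cV_n) :
  inner (tens a b) (tens a' b') = inner a a' * inner b b'.
Proof.
rewrite !innerE mxtens.mulr_sum; apply: eq_bigr => k _.
case: (mxtens.mxtens_indexP k) => i j; rewrite mxtens.mxtens_indexK /=.
by rewrite !tensE rmorphM mulrACA.
Qed.

Lemma tens_eq0 m n (a : 'cV[C]_m) (b : 'cV_n) :
  (tens a b == 0) = (a == 0) || (b == 0).
Proof. by rewrite -!inner_self_eq0 inner_tens mulf_eq0. Qed.

Lemma tensmx1 m n : (1%:M : 'M[C]_m) *t (1%:M : 'M[C]_n) = 1%:M.
Proof.
apply/matrixP => i j; case: (mxtens.mxtens_indexP i) => i0 i1.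
case: (mxtens.mxtens_indexP j) => j0 j1.
rewrite mxtens.tensmxE !mxE -natrM mulnb -xpair_eqE.
by rewrite (can_eq (@mxtens.mxtens_indexK m n)).
Qed.

Lemma measurement_tensl m n k (dim : 'I_k -> nat)
    (M : forall i, 'M[C]_(dim i, m)) :
  measurement M -> measurement (fun i => M i *t (1%:M : 'M_n)).
Proof.
move=> MM; rewrite /measurement -tensmx1 -[in RHS]MM.
apply/matrixP => i j; rewrite summxE; case: (mxtens.mxtens_indexP i) => i0 i1.
case: (mxtens.mxtens_indexP j) => j0 j1.
rewrite mxtens.tensmxE summxE mulr_suml; apply: eq_bigr => l _.
by rewrite adjoint_tens mxtens.tensmx_mul mulmx1 trmx1 map_mx1 mxtens.tensmxE.
Qed.

Lemma measurement_tensr m n k (dim : 'I_k -> nat)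
    (N : forall j, 'M[C]_(dim j, n)) :
  measurement N -> measurement (fun j => (1%:M : 'M_m) *t N j).
Proof.
move=> NN; rewrite /measurement -tensmx1 -[in RHS]NN.
apply/matrixP => i j; rewrite summxE; case: (mxtens.mxtens_indexP i) => i0 i1.
case: (mxtens.mxtens_indexP j) => j0 j1.
rewrite mxtens.tensmxE summxE mulr_sumr; apply: eq_bigr => l _.
by rewrite adjoint_tens mxtens.tensmx_mul mulmx1 trmx1 map_mx1 mxtens.tensmxE.
Qed.

End InnerProduct.

(** * What an LOCC protocol that never errs imposes on the states *)

Section Protocols.
Variables (C : numClosedFieldType) (X : eqType).

(** A measurement preserves inner products once summed over its outcomes, so induction reduces the
    claim to a leaf; the single label announced there forces one of the two states to vanish. *)
Lemma announces_inner0 m n (P : locc_protocol C X m n) x y psi phi :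
  announces P x psi -> announces P y phi -> x != y -> inner psi phi = 0.
Proof.
elim: P psi phi => {m n} [m n z|m n k dim M MM Q IH|m n k dim N NN Q IH]
  psi phi /= px py xy; last first.
- rewrite -(sum_inner_measurement psi phi (measurement_tensr m NN)).
  by apply: big1 => j _; apply: (IH j) xy; [exact: px|exact: py].
- rewrite -(sum_inner_measurement psi phi (measurement_tensl n MM)).
  by apply: big1 => i _; apply: (IH i) xy; [exact: px|exact: py].
have [->|psi0] := eqVneq psi 0; first by rewrite inner0l.
have [->|phi0] := eqVneq phi 0; first by rewrite inner0r.
by move: xy; rewrite -(px psi0) -(py phi0) eqxx.
Qed.

Lemma announces0 m n (P : locc_protocol C X m n) x : announces P x 0.
Proof.
elim: P => {m n} [m n z|m n k dim M MM Q IH|m n k dim N NN Q IH] /=.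
- by rewrite eqxx.
- by move=> i; rewrite mulmx0.
by move=> j; rewrite mulmx0.
Qed.

(* The states remain indistinguishable after any scaled local isometries, which
   is the invariant kept by the branches of positive probability. *)
Lemma rigid_not_announced (I : eqType) (m0 n0 : nat)
    (a : I -> 'cV[C]_m0) (b : I -> 'cV[C]_n0) (lab : I -> X) (i0 j0 : I) :
    injective lab -> i0 != j0 ->
    (forall i, a i != 0) -> (forall i, b i != 0) ->
    (forall E : 'M_m0,
       (forall i j, i != j -> inner (a i) (E *m a j) * inner (b i) (b j) = 0) ->
       is_scalar_mx E) ->
    (forall E : 'M_n0,
       (forall i j, i != j -> inner (a i) (a j) * inner (b i) (E *m b j) = 0) ->
       is_scalar_mx E) ->
  forall m n (P : locc_protocol C X m n) (A : 'M_(m, m0)) (B : 'M_(n, n0)) c c',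
    c != 0 -> c' != 0 -> A ^t* *m A = c%:M -> B ^t* *m B = c'%:M ->
    ~ (forall i, announces P (lab i) (tens (A *m a i) (B *m b i))).
Proof.
move=> labI ij0 a0 b0 rigA rigB m n.
elim=> {m n} [m n x|m n k dim M MM Q IH|m n k dim N NN Q IH] A B c c' c0 c'0
  AA BB /= annP.
(* At a leaf no state is zero, so the one announced label would be that of every state. *)
- have lab_x i : x = lab i.
    apply: annP; rewrite tens_eq0 -!inner_self_eq0 !inner_mulmx !mulmxA AA BB.
    by rewrite !mul_scalar_mx !innerZr !mulf_eq0 !inner_self_eq0
      (negPf c0) (negPf c'0) (negPf (a0 i)) (negPf (b0 i)).
  by move: ij0; rewrite -(inj_eq labI) -!lab_x eqxx.
(* Differently labelled states stay orthogonal after outcome [l]. Bob's side only contributes the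
   nonzero factor [c'], so the measurement operator pulled back to the original space satisfies the
   premise of [rigA]. *)
- have scal l : exists e, A ^t* *m ((M l) ^t* *m M l) *m A = e%:M.
    apply/is_scalar_mxP; apply: rigA => i j ij.
    have := announces_inner0 (annP i l) (annP j l).
    rewrite (inj_eq labI) => /(_ ij); rewrite !mul_tens inner_tens !mul1mx.
    rewrite !inner_mulmx !mulmxA BB mul_scalar_mx innerZr mulrCA.
    by move/eqP; rewrite mulf_eq0 (negPf c'0) -!mulmxA => /eqP.
  have [e eM] := fin_all_exists scal.
  (* The squared norms over the outcomes add up to that of [A *m a i0], which is nonzero; so some
     outcome has a nonzero scalar, and the induction continues in its branch. *)
  have [l el] : exists l, e l != 0.
    apply/existsP; apply: contraR c0; rewrite negb_exists => /forallP e0.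
    have /eqP := sum_inner_measurement (A *m a i0) (A *m a i0) MM.
    rewrite big1 => [|l _]; last first.
      by rewrite inner_sandwich eM (eqP (negPn (e0 l))) mul_scalar_mx scale0r inner0r.
    rewrite eq_sym inner_mulmx mulmxA AA mul_scalar_mx innerZr mulf_eq0.
    by rewrite inner_self_eq0 (negPf (a0 i0)) orbF.
  apply: (IH l (M l *m A) B (e l) c' el c'0 _ BB) => [|i].
    by rewrite adjointM -eM !mulmxA.
  by have := annP i l; rewrite mul_tens mul1mx mulmxA.
- have scal l : exists e, B ^t* *m ((N l) ^t* *m N l) *m B = e%:M.
    apply/is_scalar_mxP; apply: rigB => i j ij.
    have := announces_inner0 (annP i l) (annP j l).
    rewrite (inj_eq labI) => /(_ ij); rewrite !mul_tens inner_tens !mul1mx.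
    rewrite !inner_mulmx !mulmxA AA mul_scalar_mx innerZr -mulrA.
    by move/eqP; rewrite mulf_eq0 (negPf c0) -!mulmxA => /eqP.
  have [e eN] := fin_all_exists scal.
  have [l el] : exists l, e l != 0.
    apply/existsP; apply: contraR c'0; rewrite negb_exists => /forallP e0.
    have /eqP := sum_inner_measurement (B *m b i0) (B *m b i0) NN.
    rewrite big1 => [|l _]; last first.
      by rewrite inner_sandwich eN (eqP (negPn (e0 l))) mul_scalar_mx scale0r inner0r.
    rewrite eq_sym inner_mulmx mulmxA BB mul_scalar_mx innerZr mulf_eq0.
    by rewrite inner_self_eq0 (negPf (b0 i0)) orbF.
  apply: (IH l A (N l *m B) c (e l) c0 el AA) => [|i].
    by rewrite adjointM -eN !mulmxA.
  by have := annP i l; rewrite mul_tens mul1mx mulmxA.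
Qed.

End Protocols.

(** * Protocols built from projective measurements that sort states into classes *)

Section Sorting.
Variable C : numClosedFieldType.

(** With [P] the projection, the rows of [P] lie in [U] and those of [1 - P] are orthogonal to [U].
    Hence [P ^t* = P *m P ^t*], whose right side is self-adjoint. *)
Lemma proj_ortho_hermitian p m (U : 'M[C]_(p, m)) :
  (spectral.proj_ortho U) ^t* = spectral.proj_ortho U.
Proof.
set P := spectral.proj_ortho U.
have PPP : P ^t* = P *m P ^t*.
  have /submxP[D PD] : (P <= U)%MS by rewrite -[P]mul1mx spectral.proj_ortho_sub.
  have /spectral.orthomx1P := spectral.proj_ortho_compl_sub U (1%:M : 'M_m).
  rewrite mul1mx -/P mulmxBl mul1mx => /eqP; rewrite subr_eq0 => /eqP UPU.
  by rewrite [in P ^t*]PD adjointM mulmxA -UPU.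
by rewrite {1}PPP -{1}[P]spectral.trmxCK -adjointM -PPP spectral.trmxCK.
Qed.

(** The projections need not add up to the identity. The missing part is absorbed by the outcome
    [k0], whose operator becomes the complement of the sum [Q] of all the others. *)
Lemma hermitian_idempotents_measurement m (K : finType) (k0 : K)
    (P : K -> 'M[C]_m) :
  (forall k, (P k) ^t* = P k) ->
  (forall k l, P k *m P l = if k == l then P k else 0) ->
  exists M : K -> 'M[C]_m,
    [/\ \sum_k (M k) ^t* *m M k = 1%:M,
        forall k (v : 'cV_m), P k *m v = v -> M k *m v = v &
        forall k l (v : 'cV_m), P k *m v = v -> k != l -> M l *m v = 0].
Proof.
move=> Pherm PP; pose Q := \sum_(k | k != k0) P k.
have QQ : Q *m Q = Q.
  rewrite {1}/Q mulmx_suml; apply: eq_bigr => k kk0.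
  rewrite mulmx_sumr (bigD1 k) //= PP eqxx big1 ?addr0 // => l /andP[_ lk].
  by rewrite PP eq_sym (negPf lk).
have Qherm : Q ^t* = Q.
  by rewrite /Q adjoint_sum; apply: eq_bigr => k _; rewrite Pherm.
have Qv k (v : 'cV_m) : P k *m v = v -> Q *m v = if k == k0 then 0 else v.
  move=> Pv; rewrite -Pv mulmxA mulmx_suml; have [->|kk0] := eqVneq k k0.
    by rewrite big1 ?mul0mx // => l lk0; rewrite PP (negPf lk0).
  rewrite (bigD1 k) //= PP eqxx big1 ?addr0 // => l /andP[_ lk].
  by rewrite PP (negPf lk).
exists (fun k => if k == k0 then 1%:M - Q else P k); split.
- rewrite (bigD1 k0) //= eqxx.
  have -> : (1%:M - Q) ^t* = 1%:M - Q.
    by rewrite linearB /= map_mxB trmx1 map_mx1 Qherm.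
  rewrite mulmxBl mul1mx mulmxBr mulmx1 QQ subrr subr0.
  rewrite -[RHS](subrK Q); congr (_ + _); apply: eq_bigr => k kk0.
  by rewrite (negPf kk0) Pherm PP eqxx.
- move=> k v Pv; case: eqP => // kk0.
  by rewrite mulmxBl mul1mx (Qv k) // kk0 eqxx subr0.
move=> k l v Pv kl; have [lk0|_] := eqVneq l k0.
  by rewrite mulmxBl mul1mx (Qv k) // -lk0 (negPf kl) subrr.
by rewrite -Pv mulmxA PP eq_sym (negPf kl) mul0mx.
Qed.

Lemma sorting_measurement m (I K : finType) (J : pred I) (a : I -> 'cV[C]_m)
    (c : I -> K) (k0 : K) :
  (forall i j, J i -> J j -> c i != c j -> inner (a i) (a j) = 0) ->
  exists M : 'I_#|K| -> 'M[C]_m, measurement M /\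
    forall i k, J i ->
      M k *m a i = if c i == enum_val k then a i else 0.
Proof.
move=> orth_a.
(* The row space of [U k] is spanned by the adjoints of the vectors of class [k]; all other indices
   give zero rows. *)
pose U k : 'M_(#|I|, m) :=
  \matrix_(x, y) (if J (enum_val x) && (c (enum_val x) == k)
                  then (a (enum_val x)) ^t* 0 y else 0).
pose P k := spectral.proj_ortho (U k).
have UU k l : k != l -> U k *m (U l) ^t* = 0.
  move=> kl; apply/matrixP => x y; rewrite !mxE.
  case: (boolP (J (enum_val x) && (c (enum_val x) == k))) => [/andP[Jx cx]|nx].
    case: (boolP (J (enum_val y) && (c (enum_val y) == l))) => [/andP[Jy cy]|ny].
      transitivity (inner (a (enum_val x)) (a (enum_val y))); last first.
        by apply: orth_a; rewrite // (eqP cx) (eqP cy).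
      rewrite innerE; apply: eq_bigr => z _.
      by rewrite !mxE Jx Jy cx cy conjCK.
    by apply: big1 => z _; rewrite !mxE (negPf ny) rmorph0 mulr0.
  by apply: big1 => z _; rewrite !mxE (negPf nx) mul0r.
have PP k l : P k *m P l = if k == l then P k else 0.
  have [->|kl] := eqVneq k l; first exact: spectral.proj_ortho_proj.
  have /submxP[D ->] : (P k <= U k)%MS.
    by rewrite -[P k]mul1mx spectral.proj_ortho_sub.
  rewrite -mulmxA [_ *m P l]spectral.proj_ortho_0 ?mulmx0 //.
  by apply/spectral.orthomx1P/UU.
have Pa i : J i -> P (c i) *m a i = a i.
  (* [proj_ortho] fixes row vectors by acting on the right; taking adjoints turns this into an
     action on columns. *)
  move=> Ji; rewrite -[LHS]spectral.trmxCK adjointM proj_ortho_hermitian.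
  rewrite spectral.proj_ortho_id ?spectral.trmxCK //.
  suff -> : (a i) ^t* = row (enum_rank i) (U (c i)) by apply: row_sub.
  by apply/rowP => y; rewrite !mxE enum_rankK Ji eqxx.
have [M [MM Mid M0]] := hermitian_idempotents_measurement k0
  (fun k => proj_ortho_hermitian (U k)) PP.
exists (M \o enum_val); split=> [|i k Ji /=].
  by rewrite /measurement -MM [RHS]big_enum_val.
case: eqP => [<-|/eqP ck]; first exact/Mid/Pa.
exact: M0 (Pa i Ji) ck.
Qed.

Variables (X : eqType) (I : finType) (lab : I -> X).

(** [J] records which states are still possible after the earlier outcomes. *)
Definition discriminable m n (a : I -> 'cV[C]_m) (b : I -> 'cV[C]_n)
    (J : pred I) : Prop :=
  exists P : locc_protocol C X m n,
    forall i, J i -> announces P (lab i) (tens (a i) (b i)).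

Lemma discriminable_same m n (a : I -> 'cV[C]_m) (b : I -> 'cV[C]_n)
    (J : pred I) :
  (forall i j, J i -> J j -> i = j) -> X -> discriminable a b J.
Proof.
move=> J1 x; case: (pickP J) => [i Ji|J0]; last first.
  by exists (Announce C m n x) => i; rewrite J0.
by exists (Announce C m n (lab i)) => j Jj /= _; rewrite (J1 i j).
Qed.

(** Projecting onto the spans of the classes leaves each state untouched in the branch of its own
    class and kills it in the others, where [announces0] applies. *)
Lemma alice_sorts (K : finType) (c : I -> K) (k0 : K) m n
    (a : I -> 'cV[C]_m) (b : I -> 'cV[C]_n) (J : pred I) :
  (forall i j, J i -> J j -> c i != c j -> inner (a i) (a j) = 0) ->
  (forall k, discriminable a b (fun i => J i && (c i == k))) ->
  discriminable a b J.
Proof.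
move=> /(sorting_measurement k0)[M [MM Ma]] discr.
have [Q annQ] := fin_all_exists (fun k : 'I_#|K| => discr (enum_val k)).
exists (AliceMeasures MM Q) => i Ji /= k; rewrite mul_tens mul1mx Ma //.
case: eqP => [ck|_]; first by apply: annQ; rewrite Ji ck eqxx.
have -> : tens (0 : 'cV_m) (b i) = 0 by apply/eqP; rewrite tens_eq0 eqxx.
exact: announces0.
Qed.

Lemma bob_sorts (K : finType) (c : I -> K) (k0 : K) m n
    (a : I -> 'cV[C]_m) (b : I -> 'cV[C]_n) (J : pred I) :
  (forall i j, J i -> J j -> c i != c j -> inner (b i) (b j) = 0) ->
  (forall k, discriminable a b (fun i => J i && (c i == k))) ->
  discriminable a b J.
Proof.
move=> /(sorting_measurement k0)[M [MM Mb]] discr.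
have [Q annQ] := fin_all_exists (fun k : 'I_#|K| => discr (enum_val k)).
exists (BobMeasures MM Q) => i Ji /= k; rewrite mul_tens mul1mx Mb //.
case: eqP => [ck|_]; first by apply: annQ; rewrite Ji ck eqxx.
have -> : tens (a i) (0 : 'cV_n) = 0 by apply/eqP; rewrite tens_eq0 eqxx orbT.
exact: announces0.
Qed.

End Sorting.

(** * Partial traces and a dimension bound that rules out local redundancy *)

Section Redundancy.
Variable C : numClosedFieldType.

(** The rescaled adjoints form a left inverse of the matrix with columns [y k]. *)
Lemma orthogonal_family_card m K (y : 'I_K -> 'cV[C]_m) :
  (forall k, y k != 0) -> (forall k l, k != l -> inner (y k) (y l) = 0) ->
  (K <= m)%N.
Proof.
move=> y0 y_orth.
pose A : 'M_(K, m) := \matrix_(k, x) ((inner (y k) (y k))^-1 * (y k x 0)^*).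
pose B : 'M_(m, K) := \matrix_(x, k) y k x 0.
suff AB : A *m B = 1%:M by apply: (mulmx1_min AB).
apply/matrixP => k l; rewrite !mxE.
transitivity ((inner (y k) (y k))^-1 * inner (y k) (y l)).
  rewrite [inner (y k) (y l)]innerE mulr_sumr; apply: eq_bigr => x _.
  by rewrite !mxE mulrA.
have [<-|kl] := eqVneq k l; first by rewrite mulVf ?inner_self_eq0 ?y0.
by rewrite (y_orth k l kl) mulr0.
Qed.

Lemma card_multi_index (I : finType) (p : I -> nat) :
  #|multi_index p| = (\prod_i p i)%N.
Proof.
rewrite card_dep_ffun foldrE big_image /=.
by apply: eq_bigr => i _; rewrite card_ord.
Qed.

Lemma card_restricted_multi_index (I : finType) (p : I -> nat) (T : {set I}) :
  #|multi_index (fun j : {i | i \in T} => p (val j))| = (\prod_(i in T) p i)%N.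
Proof. by rewrite card_multi_index [RHS]big_sub. Qed.

Lemma restrict_inj (I : finType) (p : I -> nat) (T : {set I})
    (u v : multi_index p) :
  Defs.restrict (~: T) u = Defs.restrict (~: T) v ->
  Defs.restrict T u = Defs.restrict T v -> u = v.
Proof.
move=> uvC uvT; apply/ffunP => i; case: (boolP (i \in T)) => [iT|iNT].
  by move/ffunP/(_ (exist _ i iT)): uvT; rewrite !ffunE.
rewrite -in_setC in iNT.
by move/ffunP/(_ (exist _ i iNT)): uvC; rewrite !ffunE.
Qed.

(** A multi-index is determined by its restrictions to [T] and to the complement of [T], so exactly
    one [z] and one row contribute to each diagonal entry, and none off the diagonal. *)
Lemma sum_partial_bra k (p : 'I_k -> nat) (T : {set 'I_k}) :
  \sum_(z : multi_index (fun j : {i | i \in T} => p (val j)))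
    (partial_bra C z) ^t* *m partial_bra C z = 1%:M.
Proof.
apply/matrixP => u v; rewrite summxE !mxE.
pose x0 := enum_rank (Defs.restrict (~: T) (enum_val u)).
rewrite (bigD1 (Defs.restrict T (enum_val u))) //= big1 => [|z zu]; last first.
  rewrite mxE big1 // => x _; rewrite !mxE.
  by rewrite [_ == z]eq_sym (negPf zu) andbF rmorph0 mul0r.
rewrite addr0 mxE (bigD1 x0) //= big1 => [|x xx0]; last first.
  rewrite !mxE -(can_eq enum_rankK) enum_valK eq_sym (negPf xx0).
  by rewrite rmorph0 mul0r.
rewrite addr0 !mxE enum_rankK !eqxx rmorph1 mul1r.
congr (nat_of_bool _)%:R; have [<-|uv] := eqVneq u v; first by rewrite !eqxx.
apply/negbTE/negP => /andP[/eqP uvC /eqP uvT]; case/negP: uv.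
by apply/eqP/enum_val_inj/(restrict_inj (esym uvC) (esym uvT)).
Qed.

Lemma tr_gram (Q : finType) m (v u : Q -> 'cV[C]_m) :
  \tr ((\sum_q v q *m (v q) ^t*) ^t* *m (\sum_q u q *m (u q) ^t*)) =
  \sum_q \sum_r inner (v q) (u r) * (inner (v q) (u r))^*.
Proof.
rewrite adjoint_sum mulmx_suml raddf_sum; apply: eq_bigr => q _ /=.
rewrite mulmx_sumr raddf_sum; apply: eq_bigr => r _ /=.
rewrite adjointM spectral.trmxCK mulmxA mxtrace_mulC -inner_conj.
by rewrite trace_mx11 !mulmxA -mulmxA mxE big_ord1 mulrC.
Qed.

(** By [tr_gram] the trace is a sum of squared moduli, so every term vanishes. *)
Lemma tr_gram_eq0 (Q : finType) m (v u : Q -> 'cV[C]_m) :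
  \tr ((\sum_q v q *m (v q) ^t*) ^t* *m (\sum_q u q *m (u q) ^t*)) = 0 ->
  forall q r, inner (v q) (u r) = 0.
Proof.
have ge0 q r : true -> 0 <= inner (v q) (u r) * (inner (v q) (u r))^*.
  by rewrite mul_conjC_ge0.
rewrite tr_gram => sum0 q r; apply/eqP; rewrite -mul_conjC_eq0; apply/eqP.
apply: (psumr_eq0P (ge0 q)) => //.
by apply: (psumr_eq0P _ sum0) => // q' _; apply: sumr_ge0 => r' _; apply: ge0.
Qed.

Section Discarding.
Variables (m k : nat) (p : 'I_k -> nat) (U : 'M[C]_(#|multi_index p|, m)).
Variable T : {set 'I_k}.
Hypothesis factU : tensor_factorization U.

(** The unnormalized vector left on the kept factors when the discarded ones are projected onto the
    basis vector [z]; the partial trace of [a *m a ^t*] is the sum over [z] of the rank-one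
    operators of these vectors. *)
Definition discard_component
    (z : multi_index (fun j : {i | i \in T} => p (val j)))
    (a : 'cV[C]_m) := partial_bra C z *m U *m a.

Lemma sum_discard_component a a' :
  \sum_z inner (discard_component z a) (discard_component z a') = inner a a'.
Proof.
case: factU => _ UU _; transitivity (inner (U *m a) (U *m a')); last first.
  by rewrite inner_mulmx mulmxA UU mul1mx.
rewrite -[U *m a' in RHS]mul1mx -(sum_partial_bra p T) mulmx_suml inner_sumr.
apply: eq_bigr => z _.
by rewrite /discard_component -!mulmxA inner_mulmx.
Qed.

Lemma discard_component_neq0 a : a != 0 -> exists z, discard_component z a != 0.
Proof.
move=> a0; apply/existsP; apply: contraR a0; rewrite negb_exists => /forallP za0.
rewrite -inner_self_eq0 -sum_discard_component big1 // => z _.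
by rewrite (eqP (negPn (za0 z))) inner0l.
Qed.

(* The discarded dimension divides m, hence is odd; being at least 2, it is at
   least 3. *)
Lemma kept_dimension : odd m -> T != set0 ->
  (3 * #|multi_index (fun j : {i | i \in ~: T} => p (val j))| <= m)%N.
Proof.
move=> odd_m /set0Pn[i0 i0T]; case: factU => p1 UU U'U.
have mE : m = (\prod_i p i)%N.
  apply/eqP; rewrite -card_multi_index eqn_leq.
  by rewrite (mulmx1_min UU) (mulmx1_min U'U).
rewrite card_restricted_multi_index.
have mT : m = ((\prod_(i in T) p i) * \prod_(i in ~: T) p i)%N.
  rewrite mE (bigID (mem T)) /=; congr (_ * _)%N.
  by apply: eq_bigl => i; rewrite inE.
rewrite mT leq_mul2r; apply/orP; right.
move: odd_m; rewrite {}mT oddM => /andP[oddT _].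
have p_gt0 : (0 < \prod_(i in T | i != i0) p i)%N.
  by rewrite prodn_cond_gt0 // => i _; apply: ltnW.
have : (1 < \prod_(i in T) p i)%N.
  by rewrite (bigD1 i0) //= (leq_trans (p1 i0)) // leq_pmulr.
by case: (\prod_(i in T) p i)%N oddT => [|[|[]]].
Qed.

(** Choosing one nonzero component of each [a l] gives an orthogonal family in the kept space, whose
    dimension is at most a third of [m]. *)
Lemma discarding_bound K (a : 'I_K -> 'cV[C]_m) :
  odd m -> T != set0 -> (forall l, a l != 0) ->
  (forall l l', l != l' -> forall z z',
     inner (discard_component z (a l)) (discard_component z' (a l')) = 0) ->
  (3 * K <= m)%N.
Proof.
move=> odd_m T0 a0 orth.
have [z za0] := fin_all_exists (fun l => discard_component_neq0 (a0 l)).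
apply: leq_trans (kept_dimension odd_m T0); rewrite leq_mul2l /=.
by apply: (orthogonal_family_card za0) => l l' ll'; apply: orth.
Qed.

End Discarding.

(** The components of a product state are tensors of local components, so [tr_gram_eq0] splits into
    products of local inner products. *)
Lemma redundant_components m n kA (pA : 'I_kA -> nat)
    (UA : 'M[C]_(#|multi_index pA|, m)) (TA : {set 'I_kA})
    kB (pB : 'I_kB -> nat) (UB : 'M[C]_(#|multi_index pB|, n)) (TB : {set 'I_kB})
    (a a' : 'cV_m) (b b' : 'cV_n) :
  \tr ((reduced_density UA TA UB TB (tens a b)) ^t*
        *m reduced_density UA TA UB TB (tens a' b')) = 0 ->
  forall z z' w w',
    inner (discard_component UA (T := TA) z a) (discard_component UA z' a') *
    inner (discard_component UB (T := TB) w b) (discard_component UB w' b') = 0.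
Proof.
have redE a0 b0 : reduced_density UA TA UB TB (tens a0 b0) =
    \sum_zw tens (discard_component UA zw.1 a0) (discard_component UB zw.2 b0)
      *m (tens (discard_component UA zw.1 a0) (discard_component UB zw.2 b0)) ^t*.
  rewrite /reduced_density pair_bigA /=; apply: eq_bigr => zw _.
  by rewrite -mul_tens adjointM !mulmxA.
by rewrite !redE => /tr_gram_eq0 red0 z z' w w';
  rewrite -inner_tens (red0 (z, w) (z', w')).
Qed.

(** States sharing a partner share a nonzero component of it, whose norm can be cancelled.
    Orthogonality of the reductions thus passes to the components of the other party, too many of
    them for [discarding_bound]. *)
Lemma locally_irredundant_criterion m n (S : {fset 'cV[C]_(m * n)})
    K (a : 'I_K -> 'cV[C]_m) (b0 : 'cV_n) L (b : 'I_L -> 'cV[C]_n) (a0 : 'cV_m) :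
  odd m -> odd n -> (m < 3 * K)%N -> (n < 3 * L)%N ->
  (forall k, a k != 0) -> b0 != 0 -> (forall l, b l != 0) -> a0 != 0 ->
  (forall k, tens (a k) b0 \in S) -> (forall l, tens a0 (b l) \in S) ->
  (forall k k', k != k' -> inner (a k) (a k') = 0) ->
  (forall l l', l != l' -> inner (b l) (b l') = 0) ->
  locally_irredundant S.
Proof.
move=> odd_m odd_n mK nL a_n0 b0_n0 b_n0 a0_n0 aS bS a_orth b_orth.
move=> [kA [pA [UA [TA [kB [pB [UB [TB [facA facB T0 red]]]]]]]]].
have neq (u v : 'cV[C]_(m * n)) : u != 0 -> inner u v = 0 -> u != v.
  by move=> u0 uv; apply: contraNneq u0 => uv'; rewrite -inner_self_eq0 {2}uv' uv.
have [w0 w0_n0] := discard_component_neq0 TB facB b0_n0.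
have [z0 z0_n0] := discard_component_neq0 TA facA a0_n0.
case/orP: T0 => T0; [move: mK|move: nL]; rewrite ltnNge => /negP; apply.
  apply: (discarding_bound facA odd_m T0 a_n0) => k k' kk' z z'.
  have /red : tens (a k) b0 != tens (a k') b0.
    apply: neq; first by rewrite tens_eq0 negb_or a_n0.
    by rewrite inner_tens a_orth ?mul0r.
  move=> /(_ (aS k) (aS k'))/redundant_components/(_ z z' w0 w0)/eqP.
  by rewrite mulf_eq0 inner_self_eq0 (negPf w0_n0) orbF => /eqP.
apply: (discarding_bound facB odd_n T0 b_n0) => l l' ll' w w'.
have /red : tens a0 (b l) != tens a0 (b l').
  apply: neq; first by rewrite tens_eq0 negb_or a0_n0 b_n0.
  by rewrite inner_tens b_orth ?mulr0.
move=> /(_ (bS l) (bS l'))/redundant_components/(_ z0 z0 w w')/eqP.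
by rewrite mulf_eq0 inner_self_eq0 (negPf z0_n0) => /eqP.
Qed.

End Redundancy.

(** * The domino states, their rigidity, and the set built from them *)

Section Construction.
Variable C : numClosedFieldType.

(** Integer coordinates let orthogonality be decided by evaluation in [int] and then carried over to
    [C]. *)
Definition int_vec (s : seq int) : 'cV[C]_3 := \col_x (s`_x)%:~R.

Definition int_dot (s t : seq int) : int :=
  s`_0 * t`_0 + s`_1 * t`_1 + s`_2 * t`_2.

Lemma sum_ord3 (V : zmodType) (F : 'I_3 -> V) :
  \sum_x F x = F (inord 0) + F (inord 1) + F (inord 2).
Proof.
rewrite !big_ord_recr big_ord0 /= add0r.
by congr (F _ + F _ + F _); apply: val_inj; rewrite /= inordK.
Qed.

Lemma inner_int_vec (s t : seq int) :
  inner (int_vec s) (int_vec t) = (int_dot s t)%:~R.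
Proof.
by rewrite innerE sum_ord3 !mxE !inordK // !rmorph_int !rmorphD !rmorphM.
Qed.

(** No conjugate appears in this sesquilinear form because the coordinates are integers. *)
Definition int_form (E : 'M[C]_3) (s t : seq int) : C :=
  \sum_(x < 3) \sum_(y < 3) (s`_x)%:~R * (t`_y)%:~R * E x y.

Lemma inner_int_form E s t :
  inner (int_vec s) (E *m int_vec t) = int_form E s t.
Proof.
rewrite innerE; apply: eq_bigr => x _; rewrite !mxE rmorph_int mulr_sumr.
by apply: eq_bigr => y _; rewrite !mxE mulrA mulrAC.
Qed.

(* Row i is the i-th domino state |alpha_i>|beta_i>: the eight border states of
   the domino basis of C^3 (x) C^3. *)
Definition domino_alice : seq (seq int) :=
  [:: [:: 1; 0; 0]; [:: 1; 0; 0]; [:: 1; 1; 0]; [:: 1; -1; 0];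
      [:: 0; 0; 1]; [:: 0; 0; 1]; [:: 0; 1; 1]; [:: 0; 1; -1]].
Definition domino_bob : seq (seq int) :=
  [:: [:: 1; 1; 0]; [:: 1; -1; 0]; [:: 0; 0; 1]; [:: 0; 0; 1];
      [:: 0; 1; 1]; [:: 0; 1; -1]; [:: 1; 0; 0]; [:: 1; 0; 0]].

Definition dot_alice i j : int :=
  int_dot (nth [::] domino_alice i) (nth [::] domino_alice j).
Definition dot_bob i j : int :=
  int_dot (nth [::] domino_bob i) (nth [::] domino_bob j).

Lemma all_ord8 (P : nat -> nat -> bool) :
  all (fun i => all (P i) (iota 0 8)) (iota 0 8) -> forall i j : 'I_8, P i j.
Proof.
by move=> /allP Pall i j; apply: (allP (Pall i _)); rewrite mem_iota ltn_ord.
Qed.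

Lemma domino_orthogonal (i j : 'I_8) :
  i != j -> dot_alice i j * dot_bob i j = 0.
Proof.
rewrite -(inj_eq val_inj) => ij; apply/eqP.
by have /implyP -> := all_ord8
  (P := fun i j => (i != j) ==> (dot_alice i j * dot_bob i j == 0)) isT i j.
Qed.

Lemma domino_neq0 (i : 'I_8) : (dot_alice i i != 0) && (dot_bob i i != 0).
Proof.
exact: (all_ord8
  (P := fun i _ => (dot_alice i i != 0) && (dot_bob i i != 0)) isT i i).
Qed.

(* Within each half of the domino set, Bob can separate these three classes and
   Alice can then separate the members of each class. *)
Definition domino_class (i : nat) : 'I_3 := inord (minn (i %% 4) 2).

Lemma domino_class_eq (i j : nat) :
  (domino_class i == domino_class j) = (minn (i %% 4) 2 == minn (j %% 4) 2).
Proof. by rewrite -(inj_eq val_inj) /= !inordK // ltnS geq_minr. Qed.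

Lemma bob_separates_classes (i j : 'I_8) :
  (i < 4)%N == (j < 4)%N -> domino_class i != domino_class j -> dot_bob i j = 0.
Proof.
rewrite domino_class_eq => ij cij; apply/eqP.
by have /implyP -> // := all_ord8 (P := fun i j =>
  ((i < 4)%N == (j < 4)%N) && (minn (i %% 4) 2 != minn (j %% 4) 2) ==>
  (dot_bob i j == 0)) isT i j; rewrite ij.
Qed.

Lemma alice_separates_members (i j : 'I_8) :
  (i < 4)%N == (j < 4)%N -> domino_class i == domino_class j -> i != j ->
  dot_alice i j = 0.
Proof.
rewrite domino_class_eq -(inj_eq val_inj) => ij cij nij; apply/eqP.
by have /implyP -> // := all_ord8 (P := fun i j =>
  [&& (i < 4)%N == (j < 4)%N, minn (i %% 4) 2 == minn (j %% 4) 2 & i != j] ==>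
  (dot_alice i j == 0)) isT i j; rewrite ij cij.
Qed.

(** Separates the two entries seen by a pair of domino vectors that differ by a relative sign. *)
Lemma add_sub_eq0 (x y : C) : x + y = 0 -> x - y = 0 -> x = 0 /\ y = 0.
Proof.
move=> xy /eqP; rewrite subr_eq0 => /eqP xE; move: xy; rewrite xE -mulr2n => /eqP.
by rewrite mulrn_eq0 /= => /eqP.
Qed.

Lemma scalar3 (E : 'M[C]_3) (e := fun x y => E (inord x) (inord y)) :
  e 0%N 1%N = 0 -> e 0%N 2%N = 0 -> e 1%N 0%N = 0 -> e 1%N 2%N = 0 ->
  e 2%N 0%N = 0 -> e 2%N 1%N = 0 -> e 0%N 0%N = e 1%N 1%N ->
  e 1%N 1%N = e 2%N 2%N -> is_scalar_mx E.
Proof.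
move=> e01 e02 e10 e12 e20 e21 e00 e11; apply/is_scalar_mxP; exists (e 0%N 0%N).
apply/matrixP => x y; rewrite !mxE -[x]inord_val -[y]inord_val -(inj_eq val_inj).
rewrite /= !inordK // -/(e x y).
case: x y => [[|[|[]]] //= ?] [[|[|[]]] //= ?];
  by rewrite ?mulr1n ?mulr0n ?e00 ?e11.
Qed.

Let int_entries :=
  (mulr0z (1 : C), mulr1z (1 : C), mulrN1z (1 : C), mul0r, mulr0, mul1r, mulr1,
   mulN1r, add0r, addr0).

(** Pairs whose Bob parts overlap constrain [E]. State 0 against 6 and 7 kills the off-diagonal
    entries of row and column 0; 2 against 4 then kills the remaining ones; the pairs 2, 3 and 6, 7
    equate the diagonal entries. *)
Lemma domino_rigid_alice (E : 'M[C]_3) :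
  (forall i j : 'I_8, i != j ->
     int_form E (nth [::] domino_alice i) (nth [::] domino_alice j) *
     (dot_bob i j)%:~R = 0) ->
  is_scalar_mx E.
Proof.
move=> orth.
have form0 i j : (i < 8)%N -> (j < 8)%N -> i != j -> dot_bob i j != 0 ->
    int_form E (nth [::] domino_alice i) (nth [::] domino_alice j) = 0.
  move=> i8 j8 ij oij; have /eqP := orth (Ordinal i8) (Ordinal j8) ij.
  by rewrite mulf_eq0 intr_eq0 (negPf oij) orbF => /eqP.
have f06 := form0 0%N 6%N isT isT isT isT.
rewrite /int_form /= !sum_ord3 !inordK //= !int_entries in f06.
have f07 := form0 0%N 7%N isT isT isT isT.
rewrite /int_form /= !sum_ord3 !inordK //= !int_entries in f07.
have f60 := form0 6%N 0%N isT isT isT isT.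
rewrite /int_form /= !sum_ord3 !inordK //= !int_entries in f60.
have f70 := form0 7%N 0%N isT isT isT isT.
rewrite /int_form /= !sum_ord3 !inordK //= !int_entries in f70.
have f24 := form0 2%N 4%N isT isT isT isT.
rewrite /int_form /= !sum_ord3 !inordK //= !int_entries in f24.
have f42 := form0 4%N 2%N isT isT isT isT.
rewrite /int_form /= !sum_ord3 !inordK //= !int_entries in f42.
have f23 := form0 2%N 3%N isT isT isT isT.
rewrite /int_form /= !sum_ord3 !inordK //= !int_entries in f23.
have f67 := form0 6%N 7%N isT isT isT isT.
rewrite /int_form /= !sum_ord3 !inordK //= !int_entries in f67.
have [e01 e02] := add_sub_eq0 f06 f07.
have [e10 e20] := add_sub_eq0 f60 f70.
move: f24 f42; rewrite e02 e20 !add0r => e12 e21.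
apply: scalar3 => //.
- by apply/eqP; rewrite -subr_eq0; move: f23; rewrite e01 e10 subr0 add0r => ->.
- by apply/eqP; rewrite -subr_eq0; move: f67; rewrite e12 e21 subr0 add0r => ->.
Qed.

(** As for Alice, but starting from row and column 2: states 2 against 0 and 1, then 4 against 6,
    then the pairs 0, 1 and 4, 5. *)
Lemma domino_rigid_bob (E : 'M[C]_3) :
  (forall i j : 'I_8, i != j ->
     (dot_alice i j)%:~R *
     int_form E (nth [::] domino_bob i) (nth [::] domino_bob j) = 0) ->
  is_scalar_mx E.
Proof.
move=> orth.
have form0 i j : (i < 8)%N -> (j < 8)%N -> i != j -> dot_alice i j != 0 ->
    int_form E (nth [::] domino_bob i) (nth [::] domino_bob j) = 0.
  move=> i8 j8 ij oij; have /eqP := orth (Ordinal i8) (Ordinal j8) ij.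
  by rewrite mulf_eq0 intr_eq0 (negPf oij) => /eqP.
have f20 := form0 2%N 0%N isT isT isT isT.
rewrite /int_form /= !sum_ord3 !inordK //= !int_entries in f20.
have f21 := form0 2%N 1%N isT isT isT isT.
rewrite /int_form /= !sum_ord3 !inordK //= !int_entries in f21.
have f02 := form0 0%N 2%N isT isT isT isT.
rewrite /int_form /= !sum_ord3 !inordK //= !int_entries in f02.
have f12 := form0 1%N 2%N isT isT isT isT.
rewrite /int_form /= !sum_ord3 !inordK //= !int_entries in f12.
have f46 := form0 4%N 6%N isT isT isT isT.
rewrite /int_form /= !sum_ord3 !inordK //= !int_entries in f46.
have f64 := form0 6%N 4%N isT isT isT isT.
rewrite /int_form /= !sum_ord3 !inordK //= !int_entries in f64.
have f01 := form0 0%N 1%N isT isT isT isT.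
rewrite /int_form /= !sum_ord3 !inordK //= !int_entries in f01.
have f45 := form0 4%N 5%N isT isT isT isT.
rewrite /int_form /= !sum_ord3 !inordK //= !int_entries in f45.
have [e20 e21] := add_sub_eq0 f20 f21.
have [e02 e12] := add_sub_eq0 f02 f12.
move: f46 f64; rewrite e02 e20 !addr0 => e10 e01.
apply: scalar3 => //.
- by apply/eqP; rewrite -subr_eq0; move: f01; rewrite e01 e10 subr0 add0r => ->.
- by apply/eqP; rewrite -subr_eq0; move: f45; rewrite e12 e21 subr0 add0r => ->.
Qed.

(* Alice's space is C^3 (+) C^3 (+) C^n: each half of the domino set has its own
   copy of C^3, so that only the measurement merging the two copies hides which
   half a state belongs to. *)
Variable n : nat.
Let d := (3 + (3 + n))%N.
Definition state_index : finType := ('I_8 + 'I_n * 'I_d)%type.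

Definition domino_vec (tab : seq (seq int)) (i : nat) : 'cV[C]_3 :=
  int_vec (nth [::] tab i).

Definition alice (x : state_index) : 'cV[C]_d :=
  match x with
  | inl i => if (i < 4)%N then col_mx (domino_vec domino_alice i) 0
             else col_mx 0 (col_mx (domino_vec domino_alice i) 0)
  | inr kl => col_mx 0 (col_mx 0 (delta_mx kl.1 0))
  end.

(** Both halves use the same copy of C^3, so that merging Alice's two copies restores the domino
    states. *)
Definition bob (x : state_index) : 'cV[C]_d :=
  match x with
  | inl i => col_mx (domino_vec domino_bob i) 0
  | inr kl => delta_mx kl.2 0
  end.

(* With x^2 + y^2 = 1, kraus x y and kraus y (- x) rotate the two copies of C^3
   into each other and then project onto either of them, which is mapped to the
   first copy. *)
Definition kraus (x y : C) : 'M[C]_d :=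
  block_mx x%:M (row_mx y%:M 0) 0 (block_mx 0 0 0 x%:M).

Lemma kraus_col x y u v (w : 'cV_n) :
  kraus x y *m col_mx u (col_mx v w) = col_mx (x *: u + y *: v) (col_mx 0 (x *: w)).
Proof.
rewrite /kraus mul_block_col mul_row_col mul_block_col.
by rewrite !mul_scalar_mx !mul0mx !addr0 !add0r.
Qed.

Lemma inner_domino_alice (i j : nat) :
  inner (domino_vec domino_alice i) (domino_vec domino_alice j) =
  (dot_alice i j)%:~R.
Proof. exact: inner_int_vec. Qed.

Lemma inner_domino_bob (i j : nat) :
  inner (domino_vec domino_bob i) (domino_vec domino_bob j) =
  (dot_bob i j)%:~R.
Proof. exact: inner_int_vec. Qed.

Lemma domino_alice_neq0 (i : 'I_8) : domino_vec domino_alice i != 0.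
Proof.
rewrite -inner_self_eq0 inner_domino_alice intr_eq0.
by case/andP: (domino_neq0 i).
Qed.

Lemma domino_bob_neq0 (i : 'I_8) : domino_vec domino_bob i != 0.
Proof.
rewrite -inner_self_eq0 inner_domino_bob intr_eq0.
by case/andP: (domino_neq0 i).
Qed.

Lemma col_mx_eq0 p q (u : 'cV[C]_p) (v : 'cV_q) :
  (col_mx u v == 0) = (u == 0) && (v == 0).
Proof.
apply/eqP/andP => [|[/eqP-> /eqP->]]; last exact: col_mx0.
by rewrite -(@col_mx0 _ p q) => /eq_col_mx[-> ->].
Qed.

Lemma delta_neq0 p (k : 'I_p) : delta_mx k 0 != 0 :> 'cV[C]_p.
Proof. by rewrite -inner_self_eq0 inner_delta eqxx oner_eq0. Qed.

Lemma alice_neq0 x : alice x != 0.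
Proof.
case: x => [i|kl] /=; last by rewrite !col_mx_eq0 (negPf (delta_neq0 _)) !andbF.
by case: ifP => _; rewrite !col_mx_eq0 (negPf (domino_alice_neq0 i)) ?andbF.
Qed.

Lemma bob_neq0 x : bob x != 0.
Proof.
case: x => [i|kl] /=; last exact: delta_neq0.
by rewrite col_mx_eq0 (negPf (domino_bob_neq0 i)).
Qed.

Lemma inner_bob_inl (i j : 'I_8) :
  inner (bob (inl i)) (bob (inl j)) = (dot_bob i j)%:~R.
Proof. by rewrite inner_col_mx inner0l addr0 inner_domino_bob. Qed.

Lemma inner_alice_inl (i j : 'I_8) :
  inner (alice (inl i)) (alice (inl j)) =
  if (i < 4)%N == (j < 4)%N then (dot_alice i j)%:~R else 0.
Proof.
rewrite /=; case: (i < 4)%N; case: (j < 4)%N;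
  by rewrite !(inner_col_mx, inner0l, inner0r, addr0, add0r) ?inner_domino_alice.
Qed.

Lemma inner_alice_mixed i kl : inner (alice (inl i)) (alice (inr kl)) = 0.
Proof.
by rewrite /=; case: ifP => _;
  rewrite !(inner_col_mx, inner0l, inner0r, addr0, add0r).
Qed.

Lemma inner_alice_inr kl kl' :
  inner (alice (inr kl)) (alice (inr kl')) = (kl.1 == kl'.1)%:R.
Proof. by rewrite /= !inner_col_mx !inner0l !add0r inner_delta. Qed.

(** After the measurement the half of a domino state survives only in the scalar [x] or [y]. *)
Lemma kraus_alice x y s :
  kraus x y *m alice s =
  match s with
  | inl i => col_mx ((if (i < 4)%N then x else y) *: domino_vec domino_alice i) 0
  | inr _ => x *: alice s
  end.
Proof.
case: s => [i|kl] /=; last by rewrite kraus_col !scale_col_mx !scaler0 add0r.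
case: ifP => _; last by rewrite kraus_col !scaler0 add0r col_mx0.
by rewrite -(@col_mx0 _ 3 n) kraus_col !scaler0 addr0.
Qed.

(** * Orthogonality of the states before and after the measurement *)

Definition state x := tens (alice x) (bob x).

Lemma state_neq0 x : state x != 0.
Proof. by rewrite tens_eq0 negb_or alice_neq0 bob_neq0. Qed.

Definition kraus_state x y s := (kraus x y *t (1%:M : 'M_d)) *m state s.

Lemma inner_inr0 (f : C) (kl kl' : 'I_n * 'I_d) : kl != kl' ->
  f * (kl.1 == kl'.1)%:R * inner (bob (inr kl)) (bob (inr kl')) = 0.
Proof.
move=> neq; rewrite /= inner_delta -mulrA -natrM mulnb -xpair_eqE -!surjective_pairing.
by rewrite (negPf neq) mulr0.
Qed.

Lemma state_orthogonal s t : s != t -> inner (state s) (state t) = 0.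
Proof.
rewrite /state inner_tens.
case: s t => [i|kl] [j|kl'] neq.
- rewrite inner_alice_inl inner_bob_inl; case: ifP => _; last by rewrite mul0r.
  by rewrite -intrM domino_orthogonal.
- by rewrite inner_alice_mixed mul0r.
- by rewrite (inner_sym0 (inner_alice_mixed j kl)) mul0r.
- by rewrite inner_alice_inr -[_%:R]mul1r inner_inr0.
Qed.

(** Up to scalars the images are domino states and product basis vectors, with Alice's parts in
    different blocks; the scalars do not affect orthogonality. *)
Lemma kraus_state_orthogonal x y s t :
  s != t -> inner (kraus_state x y s) (kraus_state x y t) = 0.
Proof.
rewrite /kraus_state !mul_tens !mul1mx inner_tens !kraus_alice.
case: s t => [i|kl] [j|kl'] neq.
- rewrite inner_bob_inl inner_col_mx inner0l addr0 innerZl innerZr.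
  rewrite inner_domino_alice mulrA -!mulrA -intrM domino_orthogonal ?mulr0 //.
- by rewrite /= scale_col_mx inner_col_mx !(scaler0, inner0l, inner0r) addr0 mul0r.
- by rewrite /= scale_col_mx inner_col_mx !(scaler0, inner0l, inner0r) addr0 mul0r.
- by rewrite innerZl innerZr mulrA inner_alice_inr inner_inr0.
Qed.

Lemma kraus_state_neq0 x y s : x != 0 -> y != 0 -> kraus_state x y s != 0.
Proof.
move=> x0 y0; rewrite /kraus_state mul_tens mul1mx tens_eq0 negb_or bob_neq0 andbT.
rewrite kraus_alice; case: s => [i|kl]; last first.
  by rewrite scaler_eq0 negb_or x0 alice_neq0.
rewrite col_mx_eq0 negb_and scaler_eq0 negb_or domino_alice_neq0.
by case: ifP; rewrite ?x0 ?y0.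
Qed.

(** * The set itself: discrimination, irredundancy and hidden nonlocality *)

Definition states : {fset 'cV[C]_(d * d)} := [fset state x | x : state_index]%fset.

Lemma in_states x : state x \in states.
Proof. exact: in_imfset. Qed.

Lemma statesP psi : psi \in states -> exists x, psi = state x.
Proof. by case/imfsetP => x _ ->; exists x. Qed.

(** Alice first finds the half or the index in C^n. In a half, Bob then finds the class and Alice
    the member; otherwise Bob's basis measurement finishes. *)
Lemma states_discriminable : locally_distinguishable states.
Proof.
suff [P annP] : discriminable state alice bob (fun=> true).
  by exists P => psi /statesP[x ->]; apply: annP.
pose part (s : state_index) : bool + 'I_n :=
  match s with inl i => inl (i < 4)%N | inr kl => inr kl.1 end.
apply: (alice_sorts (c := part) (inl true)) => [[i|kl] [j|kl'] _ _ /= neq|[g|k]].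
- rewrite inner_alice_inl; case: eqP => // ij; by rewrite ij eqxx in neq.
- exact: inner_alice_mixed.
- exact/inner_sym0/inner_alice_mixed.
- rewrite inner_alice_inr; case: eqP => // ij; by rewrite ij eqxx in neq.
- pose cls (s : state_index) := if s is inl i then domino_class i else ord0.
  apply: (bob_sorts (c := cls) ord0) => [[i|//] [j|//] /= ig jg neq|c].
    rewrite inner_bob_inl bob_separates_classes //.
    by move: ig jg; rewrite !(inj_eq inl_inj) => /eqP-> /eqP->.
  apply: (alice_sorts (c := id) (inl ord0)) => [s t|s].
    case: s t => [i|//] [j|//] /= /andP[ig ic] /andP[jg jc] neq.
    rewrite inner_alice_inl; case: ifP => // ij.
    rewrite alice_separates_members // ?(eqP ic) ?(eqP jc) //.
  (* The zero vector is the dummy label for an empty class. *)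
  apply: discriminable_same; last exact: 0.
  by move=> s1 s2 /andP[_ /eqP->] /andP[_ /eqP->].
- pose label (s : state_index) : 'I_d := if s is inr kl then kl.2 else ord0.
  apply: (bob_sorts (c := label) ord0) => [[//|kl] [//|kl'] _ _ /= neq|l].
    by rewrite inner_delta (negPf neq).
  apply: discriminable_same; last exact: 0.
  case=> [//|[k1 l1]] [//|[k2 l2]] /andP[/= /eqP[->] /eqP->].
  by case/andP => /eqP[->] /eqP->.
Qed.

Lemma states_irredundant :
  odd d -> (5 <= n)%N -> locally_irredundant states.
Proof.
move=> odd_d n5; pose k0 : 'I_n := Ordinal (leq_trans (isT : (0 < 5)%N) n5).
apply: (locally_irredundant_criterion (a := fun k => alice (inr (k, ord0)))
  (b0 := delta_mx ord0 0) (b := fun l : 'I_d => delta_mx l 0)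
  (a0 := alice (inr (k0, ord0))) odd_d odd_d).
(* This is [n + 6 < 3 * n]; the next goal is the same bound for Bob's [d] vectors. *)
- by rewrite /d; lia.
- by rewrite /d; lia.
- by move=> k; apply: alice_neq0.
- exact: delta_neq0.
- by move=> l; apply: delta_neq0.
- exact: alice_neq0.
- by move=> k; apply: (in_states (inr (k, ord0))).
- by move=> l; apply: (in_states (inr (k0, l))).
- by move=> k k' kk'; rewrite inner_alice_inr (negPf kk').
- by move=> l l' ll'; rewrite inner_delta (negPf ll').
Qed.

Lemma kraus_measurement (x y : C) : x \is Num.real -> y \is Num.real ->
  x ^+ 2 + y ^+ 2 = 1 ->
  measurement (fun o : 'I_2 => if o == ord0 then kraus x y else kraus y (- x)).
Proof.
move=> /CrealP xE /CrealP yE xy1; apply: measurement_of_inner => u v.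
rewrite big_ord_recl big_ord1 /=.
rewrite -[u]vsubmxK -[v]vsubmxK -[dsubmx u]vsubmxK -[dsubmx v]vsubmxK.
move: (usubmx u) (usubmx (dsubmx u)) (dsubmx (dsubmx u)) => u1 u2 u3.
move: (usubmx v) (usubmx (dsubmx v)) (dsubmx (dsubmx v)) => v1 v2 v3.
rewrite !kraus_col !inner_col_mx !innerDl !innerDr !innerZl !innerZr.
(* The cross terms in [x * y] of the two outcomes cancel, [x] and [y] being real. *)
rewrite rmorphN /= xE yE inner0l -[RHS]mul1r -xy1; ring.
Qed.

(** A protocol for [S'] would discriminate the eight domino states, rescaled by [w] and embedded by
    the isometry [V]; nonzero weights preserve rigidity. *)
Lemma kraus_states_indistinguishable (x y : C)
    (S' : {fset 'cV[C]_(d * d)}) : x != 0 -> y != 0 ->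
  (forall i, kraus_state x y (inl i) \in S') -> locally_indistinguishable S'.
Proof.
move=> x0 y0 inS' [P annP].
pose w (i : 'I_8) := if (i < 4)%N then x else y.
have w0 i : w i != 0 by rewrite /w; case: ifP.
pose V : 'M[C]_(d, 3) := col_mx 1%:M 0.
have VV : V ^t* *m V = 1%:M.
  by rewrite tr_col_mx map_row_mx mul_row_col mulmx0 addr0 mulmx1 trmx1 map_mx1.
have lab_inj : injective (fun i : 'I_8 => kraus_state x y (inl i)).
  move=> i j ij; apply/eqP; apply: contraT => neq.
  have /(kraus_state_orthogonal x y) : inl i != inl j :> state_index by [].
  move/eqP; rewrite -ij inner_self_eq0.
  by rewrite (negPf (kraus_state_neq0 _ x0 y0)).
apply: (@rigid_not_announced C _ _ 3 3
  (fun i : 'I_8 => w i *: domino_vec domino_alice i)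
  (fun i : 'I_8 => domino_vec domino_bob i) _ ord0 ord_max lab_inj
  _ _ _ _ _ d d P V V 1 1) => // [||||||i].
- by move=> i; rewrite scaler_eq0 negb_or w0 domino_alice_neq0.
- by move=> i; apply: domino_bob_neq0.
- move=> E orth; apply: domino_rigid_alice => i j /orth/eqP.
  rewrite inner_domino_bob -scalemxAr innerZl innerZr inner_int_form -!mulrA.
  by rewrite mulf_eq0 conjC_eq0 (negPf (w0 i)) mulf_eq0 (negPf (w0 j)) => /eqP.
- move=> E orth; apply: domino_rigid_bob => i j /orth/eqP.
  rewrite innerZl innerZr inner_domino_alice inner_int_form -!mulrA.
  by rewrite mulf_eq0 conjC_eq0 (negPf (w0 i)) mulf_eq0 (negPf (w0 j)) => /eqP.
- exact: oner_neq0.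
- exact: oner_neq0.
have -> : tens (V *m (w i *: domino_vec domino_alice i))
    (V *m domino_vec domino_bob i) = kraus_state x y (inl i).
  rewrite /kraus_state mul_tens mul1mx kraus_alice !mul_col_mx !mul1mx !mul0mx.
  by [].
exact/annP/inS'.
Qed.

(** No state is killed, and the images are distinct since they are nonzero and pairwise
    orthogonal. *)
Lemma post_kraus_states (x y : C) (K := kraus x y *t (1%:M : 'M_d)) :
  x != 0 -> y != 0 ->
  (forall s, kraus_state x y s \in post_measurement_states K states) /\
  #|` post_measurement_states K states| = #|` states|.
Proof.
move=> x0 y0.
have -> : post_measurement_states K states = [fset K *m psi | psi in states]%fset.
  apply/fsetP => phi; apply/imfsetP/imfsetP => -[psi /=].
    by rewrite inE => /andP[psiS _] ->; exists psi.
  move=> psiS ->; exists psi => //=; rewrite inE psiS /=.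
  by case/statesP: psiS => s ->; apply: kraus_state_neq0.
split=> [s|]; first by apply: in_imfset; apply: in_states.
apply/card_in_imfset => _ _ /statesP[s ->] /statesP[t ->] st.
have [-> //|/(kraus_state_orthogonal x y)/eqP] := eqVneq s t.
by rewrite /kraus_state -st inner_self_eq0 (negPf (kraus_state_neq0 _ x0 y0)).
Qed.

Lemma states_hidden_nonlocality :
  odd d -> (5 <= n)%N -> genuine_hidden_nonlocality_typeI states.
Proof.
move=> odd_d n5; split; [exact: states_discriminable|exact: states_irredundant|].
(* A rational point of the unit circle with both coordinates nonzero. *)
pose x : C := 3%:R / 5%:R; pose y : C := 4%:R / 5%:R.
have x0 : x != 0 by rewrite mulf_neq0 ?invr_eq0 ?pnatr_eq0.
have y0 : y != 0 by rewrite mulf_neq0 ?invr_eq0 ?pnatr_eq0.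
have xR : x \is Num.real by rewrite realM ?realV ?realn.
have yR : y \is Num.real by rewrite realM ?realV ?realn.
have xy1 : x ^+ 2 + y ^+ 2 = 1 by rewrite /x /y; field.
pose M (o : 'I_2) := if o == ord0 then kraus x y else kraus y (- x).
have MP o : exists x' y', [/\ M o = kraus x' y', x' != 0 & y' != 0].
  by rewrite /M; case: eqP => _; [exists x, y|exists y, (- x); rewrite oppr_eq0].
(* Alice has two outcomes; Bob does nothing. *)
exists 2%N, 1%N, M, (fun=> 1%:M); split; last first.
  move=> o _ S'; have [x' [y' [Mo x'0 y'0]]] := MP o.
  have [inS' cardS'] := post_kraus_states x'0 y'0; rewrite -Mo in inS' cardS'.
  split=> //; apply: (kraus_states_indistinguishable x'0 y'0) => i.
  exact: inS'.
split; first exact: kraus_measurement.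
  by rewrite /measurement big_ord1 trmx1 map_mx1 mulmx1.
move=> o _ psi phi /statesP[s ->] /statesP[t ->] neq.
have [x' [y' [-> _ _]]] := MP o; apply/inner_eq0P/kraus_state_orthogonal.
by apply: contraNneq neq => ->.
Qed.

Lemma states_orthogonal : orthogonal_states states.
Proof.
split=> [_ /statesP[s ->]|_ _ /statesP[s ->] /statesP[t ->] neq].
  exact: state_neq0.
by apply/inner_eq0P/state_orthogonal; apply: contraNneq neq => ->.
Qed.

Lemma states_without_entanglement : without_entanglement states.
Proof. by move=> _ /statesP[s ->]; exists (alice s), (bob s). Qed.

End Construction.

Theorem theorem2 (R : realType) (d : nat) (hd : (11 <= d)%N) (hodd : odd d) :
  exists S : {fset 'cV[complex R]_(d * d)},
    [/\ orthogonal_states S, without_entanglement S &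
        genuine_hidden_nonlocality_typeI S].
Proof.
have [n n5 dE] : exists2 n, (5 <= n)%N & d = (3 + (3 + n))%N.
  by exists (d - 6)%N; lia.
move: hodd; rewrite {}dE => odd_d; exists (states (complex R) n); split.
- exact: states_orthogonal.
- exact: states_without_entanglement.
- exact: states_hidden_nonlocality.
Qed.
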